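(* Let $d\geq1$ and let $\Delta=\{\delta_k\}$ be a sequence of positive numbers tending to zero. Define $\hat N(\Delta)$ as the minimal natural number $n$ such that for all $k>n$ we have $\delta_k\leq2^d$. Then for each recurrence relation $\mathcal{R}\in\mathcal{S}_{P,\Delta}$ of order $d$ with $\rho(\mathcal{R})>0$, the solution sequences of $\mathcal{R}$ possess $(N,R,C)$-Taylor domination, where $$N=\hat N(\Delta)+d,\qquad R=2^{-(d+3)}\rho(\mathcal{R})^{-1},\qquad C=2^{(d+3)N}.$$
   Context: A recurrence relation $\mathcal{R}$ of Poincaré type (of order $d$) is one of the form $$a_k=\sum_{j=1}^d[c_j+\psi_j(k)]\,a_{k-j},\qquad k=d,d+1,\dots,\qquad \lim_{k\to\infty}\psi_j(k)=0\quad(j=1,\dots,d),$$ with $c_j,\psi_j(k)\in\mathbb{C}$. Put $\rho(\mathcal{R})=\max_j|\sigma_j|$, where $\sigma_1,\dots,\sigma_d$ are the roots of $\sigma^d-\sum_{j=1}^dc_j\sigma^{d-j}=0$. The class $\mathcal{S}_{P,\Delta}$ consists of all recurrence relations of Poincaré type with $|\psi_j(k)|\leq\delta_k\cdot\rho(\mathcal{R})^j$ for $j=1,\dots,d$ and $k=d,d+1,\dots$. Taylor domination: for a finite $R>0$, an integer $N\geq0$ and a constant $C>0$, a sequence $\{a_k\}_{k\geq0}$ possesses $(N,R,C)$-Taylor domination if $|a_k|R^k\leq C\max_{i=0,\dots,N}|a_i|R^i$ for each $k\geq N+1$. Natural numbers include $0$. *)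

(* Defs.v *)
From HB Require Import structures.
From mathcomp Require Import all_boot all_order all_algebra.
From mathcomp Require Import complex.
From mathcomp Require Import all_classical all_reals all_analysis.

Set Implicit Arguments.
Unset Strict Implicit.
Unset Printing Implicit Defensive.

Import Order.TTheory GRing.Theory Num.Theory.
Import numFieldNormedType.Exports.
Import Normc.

Local Open Scope classical_set_scope.
Local Open Scope ring_scope.
Local Open Scope complex_scope.

(* The norm `|z| of z : R[i] lives in R[i]; [normc z : R] is the same modulus as
   an element of R. *)

(* [rec_coef j] and [rec_pert j k] are c_(j+1) and psi_(j+1)(k): the index set
   {1, ..., d} is shifted to 'I_d. The values [rec_pert j k] with k < d play no
   role. The regular module R[i]^o carries the topology of the modulus. *)
Record poincare_rec (R : realType) (d : nat) := PoincareRec {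
  rec_coef : 'I_d -> R[i];
  rec_pert : 'I_d -> nat -> R[i];
  rec_pert_cvg : forall j : 'I_d,
    (rec_pert j k : R[i]^o) @[k --> \oo] --> (0 : R[i]^o) }.

Definition is_solution (R : realType) (d : nat) (rec : poincare_rec R d)
    (a : nat -> R[i]) : Prop :=
  forall k : nat, (d <= k)%N ->
    a k = \sum_(j < d) (rec_coef rec j + rec_pert rec j k) * a (k - j.+1)%N.

Definition charac_poly (R : realType) (d : nat) (rec : poincare_rec R d) :
    {poly R[i]} :=
  'X^d - \sum_(j < d) rec_coef rec j *: 'X^(d - j.+1).

Definition charac_roots (R : realType) (d : nat) (rec : poincare_rec R d) :
    seq R[i] :=
  sval (closed_field_poly_normal (charac_poly rec)).

(* Moduli are nonnegative and, for 1 <= d, the list of roots is nonempty, so the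
   default value 0 does not affect the maximum. *)
Definition rho (R : realType) (d : nat) (rec : poincare_rec R d) : R :=
  \big[Num.max/0]_(s <- charac_roots rec) normc s.

Definition class_SP (R : realType) (d : nat) (delta : nat -> R)
    (rec : poincare_rec R d) : Prop :=
  forall (j : 'I_d) (k : nat), (d <= k)%N ->
    normc (rec_pert rec j k) <= delta k * rho rec ^+ j.+1.

Definition delta_small_after (R : realType) (d : nat) (delta : nat -> R)
    (n : nat) : Prop :=
  forall k : nat, (n < k)%N -> delta k <= 2 ^+ d.

Lemma delta_small_after_ex (R : realType) (d : nat) (delta : nat -> R)
    (delta0 : delta k @[k --> \oo] --> (0 : R)) :
  exists n : nat, `[< delta_small_after d delta n >].
Proof.
have two_gt0 : (0 : R) < 2 ^+ d by rewrite exprn_gt0.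
have [n _ le_n] : \forall k \near \oo, delta k < 2 ^+ d.
  exact: (cvgr_lt _ delta0).
by exists n; apply/asboolP => k /ltnW /le_n /ltW.
Qed.

Definition N_hat (R : realType) (d : nat) (delta : nat -> R)
    (delta0 : delta k @[k --> \oo] --> (0 : R)) : nat :=
  ex_minn (delta_small_after_ex d delta0).

Definition taylor_domination (R : realType) (N : nat) (r C : R)
    (a : nat -> R[i]) : Prop :=
  [/\ 0 < r, 0 < C &
    forall k : nat, (N.+1 <= k)%N ->
      normc (a k) * r ^+ k <=
        C * \big[Num.max/0]_(i < N.+1) (normc (a i) * r ^+ i)].

(* Main.v *)
Require Import Defs.
From HB Require Import structures.
From mathcomp Require Import all_boot all_order all_algebra.
From mathcomp Require Import complex.
From mathcomp Require Import all_classical all_reals all_analysis.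
From mathcomp Require Import ring lra.

Set Implicit Arguments.
Unset Strict Implicit.
Unset Printing Implicit Defensive.

Import Order.TTheory GRing.Theory Num.Theory.
Import numFieldNormedType.Exports.
Import Normc.

Local Open Scope classical_set_scope.
Local Open Scope ring_scope.
Local Open Scope complex_scope.

(** By Vieta's formulas [c_j] is, up to sign, the elementary symmetric function
    of degree [j] in the [d] characteristic roots, all of modulus at most [rho];
    so [|c_j| <= 'C(d, j) * rho ^+ j <= 2 ^+ d * rho ^+ j]
    ([normc_rec_coef_le]). For [k] larger than the minimal threshold the
    perturbation [psi_j(k)] obeys the same bound, so that the full coefficient
    of the recurrence has modulus at most [2 ^+ d.+1 * rho ^+ j].

    Rescale by [b_k = |a_k| * r ^+ k] with [r = q / rho] and
    [q = 2 ^- (d + 3)]. The powers of [rho] cancel, and the recurrence bounds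
    [b_k] by a combination of [b_(k-1), ..., b_(k-d)] with nonnegative weights
    [2 ^+ d.+1 * q ^+ j], whose sum is at most [2 ^+ d.+1 * (2 * q) < 1]
    because the geometric series is dominated by twice its first term. A
    sequence whose terms are eventually bounded by such subconvex combinations
    of earlier terms never exceeds the maximum of its initial segment
    ([subconvex_rec_le_bigmax]). This is the domination with constant [1], and
    [1 <= 2 ^+ ((d + 3) * N)]. *)

(** * Coefficients and roots of a polynomial *)

Lemma bin_le_exp2 (n m : nat) : ('C(n, m) <= 2 ^ n)%N.
Proof.
case: (leqP m n) => [le_mn|lt_nm]; last by rewrite bin_small.
have -> : (2 ^ n = \sum_(i < n.+1) 'C(n, i))%N.
  rewrite -[2%N]/(1 + 1)%N expnDn; apply: eq_bigr => i _.
  by rewrite !exp1n !muln1.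
by rewrite (bigD1 (Ordinal (le_mn : m < n.+1)%N)) //= leq_addr.
Qed.

(** The quantitative form of Vieta's formulas: multiplying by ['X - s%:P]
    combines two consecutive bounds through Pascal's rule. *)
Lemma norm_coef_prod_XsubC_le (K : numDomainType) (M : K) (s : seq K)
    (i : nat) :
  0 <= M -> {in s, forall z, `|z| <= M} ->
  `|(\prod_(z <- s) ('X - z%:P))`_i| <= M ^+ (size s - i) *+ 'C(size s, i).
Proof.
move=> M0; elim: s i => [|z s IHs] i sM.
  by rewrite big_nil coef1 bin0n; case: i => [|i] /=; rewrite ?normr1 ?normr0.
have {}IHs j := IHs j (fun x xs => sM x (@mem_behead _ (z :: s) x xs)).
have zM : `|z| <= M by apply: sM; rewrite mem_head.
rewrite big_cons mulrBl coefB coefXM coefCM.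
apply: le_trans (ler_normB _ _) _; rewrite normrM.
case: i => [|i] /=.
  rewrite normr0 add0r bin0 mulr1n exprS.
  by apply: ler_pM => //; have := IHs 0%N; rewrite subn0 bin0.
rewrite binS subSS mulrnDr addrC lerD //.
have [le_iss|lt_si] := leqP i.+1 (size s); last first.
  have := IHs i.+1; rewrite !bin_small // !mulr0n normr_le0 => /eqP ->.
  by rewrite normr0 mulr0.
rewrite -subnSK // exprS -mulrnAr.
by apply: ler_pM => //; apply: IHs.
Qed.

(** * Moduli of complex numbers *)

Lemma real_complex_normc (R : rcfType) (z : R[i]) : (normc z)%:C = `|z|.
Proof. by case: z. Qed.

Lemma normc_ge0 (R : rcfType) (z : R[i]) : 0 <= normc z.
Proof. by case: z => x y; apply: sqrtr_ge0. Qed.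

Lemma normc_sum_le (R : rcfType) (n : nat) (F : 'I_n -> R[i]) :
  normc (\sum_i F i) <= \sum_i normc (F i).
Proof.
rewrite -lecR real_complex_normc rmorph_sum /=.
under [leRHS]eq_bigr do rewrite real_complex_normc.
exact: ler_norm_sum.
Qed.

(** * The characteristic polynomial *)

Section Characteristic.
Variables (R : realType) (d : nat) (rec : poincare_rec R d).

Lemma size_charac_low :
  (size (\sum_(j < d) rec_coef rec j *: 'X^(d - j.+1))%R <
    size ('X^d : {poly R[i]}))%N.
Proof.
rewrite size_polyXn ltnS; apply: (leq_trans (size_sum _ _ _)).
apply/bigmax_leqP => j _; apply: (leq_trans (size_scale_leq _ _)).
by rewrite size_polyXn -subSn // subSS leq_subr.
Qed.

Lemma size_charac_poly : size (charac_poly rec) = d.+1.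
Proof. by rewrite size_polyDl ?size_polyN ?size_charac_low // size_polyXn. Qed.

Lemma charac_poly_prod :
  charac_poly rec = \prod_(z <- charac_roots rec) ('X - z%:P).
Proof.
rewrite /charac_roots; case: closed_field_poly_normal => s /= {1}->.
by rewrite lead_coefDl ?size_polyN ?size_charac_low // lead_coefXn scale1r.
Qed.

Lemma size_charac_roots : size (charac_roots rec) = d.
Proof.
apply: succn_inj; rewrite -size_charac_poly charac_poly_prod.
by rewrite size_prod_XsubC.
Qed.

Lemma coef_charac_poly (j : 'I_d) :
  (charac_poly rec)`_(d - j.+1) = - rec_coef rec j.
Proof.
rewrite coefB coefXn ltn_eqF ?ltn_subrL ?(leq_ltn_trans _ (ltn_ord j)) //.
rewrite sub0r coef_sum (bigD1 j) //= coefZ coefXn eqxx mulr1 big1 ?addr0 //.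
move=> i neq_ij; rewrite coefZ coefXn.
case: eqP => [eq_sub|_]; last by rewrite mulr0.
case/eqP: neq_ij; apply/val_inj/succn_inj.
by rewrite -(subKn (ltn_ord i)) -(subKn (ltn_ord j)) eq_sub.
Qed.

Lemma rho_ge0 : 0 <= rho rec.
Proof. exact: bigmax_ge_id. Qed.

(** [- rec_coef rec j] is the coefficient of degree [d - j.+1] of a monic
    product of [d] linear factors, hence a symmetric function of degree [j.+1]
    in the roots; [rho] bounds each root. *)
Lemma normc_rec_coef_le (j : 'I_d) :
  normc (rec_coef rec j) <= 2 ^+ d * rho rec ^+ j.+1.
Proof.
rewrite -lecR real_complex_normc -normrN -coef_charac_poly charac_poly_prod.
have root_le : {in charac_roots rec, forall z, `|z| <= (rho rec)%:C}.
  by move=> z zs; rewrite -real_complex_normc lecR; apply: le_bigmax_seq.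
apply: le_trans (norm_coef_prod_XsubC_le _ _ root_le) _.
  by rewrite lecR rho_ge0.
rewrite size_charac_roots subKn // -mulr_natl -rmorphXn.
rewrite -(rmorph_nat (real_complex R)) -rmorphM lecR.
by rewrite ler_wpM2r ?exprn_ge0 ?rho_ge0 // -natrX ler_nat bin_le_exp2.
Qed.

End Characteristic.

(** * Subconvex recurrences *)

(** The discrete maximum principle: by strong induction every term lies below
    the maximum [M] of the initial segment, since the weights sum to at most
    [1] and [M] is nonnegative. *)
Lemma subconvex_rec_le_bigmax (R : realDomainType) (d N : nat) (w : 'I_d -> R)
    (b : nat -> R) :
  (forall j, 0 <= w j) -> \sum_j w j <= 1 ->
  (forall k, (N < k)%N -> b k <= \sum_(j < d) w j * b (k - j.+1)%N) ->
  forall k, b k <= \big[Num.max/0]_(i < N.+1) b i.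
Proof.
move=> w0 w1 b_rec; set M := \big[_/_]_(_ < _) _.
have M0 : 0 <= M by apply: bigmax_ge_id.
elim/ltn_ind => k IHk; have [lt_Nk|le_kN] := ltnP N k; last first.
  exact: (le_bigmax 0 (fun i : 'I_N.+1 => b i) (Ordinal (le_kN : k < N.+1)%N)).
apply: (le_trans (b_rec k lt_Nk)).
apply: (@le_trans _ _ (\sum_j w j * M)).
  apply: ler_sum => j _; apply: ler_wpM2l => //; apply: IHk.
  by rewrite ltn_subrL (leq_trans _ lt_Nk).
by rewrite -mulr_suml ler_piMl.
Qed.

Lemma geometric_sum_le (R : realFieldType) (q : R) (n : nat) :
  0 <= q <= 2^-1 -> \sum_(j < n) q ^+ j.+1 <= 2 * q.
Proof.
move=> /andP[q0 q_half]; elim: n => [|n IHn]; first by rewrite big_ord0 mulr_ge0.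
rewrite big_ord_recl expr1; under eq_bigr do rewrite exprS.
by rewrite -mulr_sumr; nra.
Qed.

(** * Taylor domination *)

Theorem corollary5p1 (R : realType) (d : nat) (d_ge1 : (1 <= d)%N)
    (delta : nat -> R) (delta_gt0 : forall k : nat, 0 < delta k)
    (delta0 : delta k @[k --> \oo] --> (0 : R))
    (rec : poincare_rec R d) (rec_SP : class_SP delta rec)
    (rho_gt0 : 0 < rho rec)
    (a : nat -> R[i]) (a_sol : is_solution rec a) :
  let N := (N_hat d delta0 + d)%N in
  taylor_domination N (2 ^- (d + 3) * (rho rec)^-1) (2 ^+ ((d + 3) * N)) a.
Proof.
move=> N; set q : R := 2 ^- (d + 3); set r := q / rho rec.
have q0 : 0 < q by rewrite invr_gt0 exprn_gt0.
have r0 : 0 < r by rewrite divr_gt0.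
have pow_q : 2 ^+ d.+1 * q = 4^-1.
  by rewrite /q addn3 !exprS; field; rewrite expf_neq0.
have pow_ge1 : 1 <= 2 ^+ d :> R by rewrite exprn_ege1 // ler1n.
have q_half : q <= 2^-1.
  by move: pow_q; rewrite exprS; nra.
split=> // k lt_Nk.
have delta_small m : (N_hat d delta0 < m)%N -> delta m <= 2 ^+ d.
  by rewrite /N_hat; case: ex_minnP => n /asboolP small _; apply: small.
apply: (@le_trans _ _ (\big[Num.max/0]_(i < N.+1) (normc (a i) * r ^+ i)));
  last first.
  apply: ler_peMl; first exact: bigmax_ge_id.
  by rewrite exprn_ege1 // ler1n.
(* The two powers of 2 bounding the unperturbed coefficient and the
   perturbation add up to the factor 2 ^+ d.+1 of the weights. *)
pose w (j : 'I_d) := 2 ^+ d.+1 * q ^+ j.+1.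
apply: (@subconvex_rec_le_bigmax _ d N w (fun m => normc (a m) * r ^+ m)).
- by move=> j; rewrite mulr_ge0 ?exprn_ge0 // ltW.
- have q_bounds : 0 <= q <= 2^-1 by rewrite ltW.
  have two_pow_ge0 : 0 <= 2 ^+ d.+1 :> R by rewrite exprn_ge0.
  rewrite -mulr_sumr.
  apply: le_trans (ler_wpM2l two_pow_ge0 (geometric_sum_le d q_bounds)) _.
  by rewrite mulrCA pow_q; lra.
move=> m lt_Nm.
have le_dm : (d <= m)%N by apply: leq_trans (ltnW lt_Nm); rewrite leq_addl.
have small_m := delta_small m (leq_ltn_trans (leq_addr _ _) lt_Nm).
rewrite (a_sol m le_dm).
apply: le_trans (ler_wpM2r (exprn_ge0 _ (ltW r0)) (normc_sum_le _)) _.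
rewrite mulr_suml; apply: ler_sum => j _.
have -> : r ^+ m = r ^+ j.+1 * r ^+ (m - j.+1).
  by rewrite -exprD subnKC // (leq_trans (ltn_ord j)).
rewrite normcM mulrACA.
apply: ler_wpM2r; first by rewrite mulr_ge0 ?normc_ge0 ?exprn_ge0 // ltW.
have -> : w j = 2 ^+ d.+1 * rho rec ^+ j.+1 * r ^+ j.+1.
  by rewrite /w -mulrA -exprMn mulrCA mulfV ?mulr1 // gt_eqF.
apply: ler_wpM2r; first by rewrite exprn_ge0 // ltW.
apply: le_trans (le_normcD _ _) _.
rewrite exprS -mulrA mulr_natl mulr2n lerD ?normc_rec_coef_le //.
apply: le_trans (rec_SP j m le_dm) _.
by rewrite ler_wpM2r // exprn_ge0 // ltW.
Qed.
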